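(* Let $R$ be an elementary divisor ring with the $DK$-property. Then for each matrix $A$ over $R$ there exists a matrix $C=\mathrm{diag}(\varepsilon_1,\ldots,\varepsilon_k,0,\ldots,0)$ of the same size such that $A\sim C$, the elements $\varepsilon_1,\ldots,\varepsilon_{k-1}$ are duo elements, and $R\varepsilon_{i+1}R\subseteq R\varepsilon_i\cap\varepsilon_iR$ for $i=1,\ldots,k-1$.
   Context: Rings are associative (not necessarily commutative) with $1\neq 0$. $\mathrm{diag}(d_1,\ldots,d_s)$ denotes a possibly rectangular $n\times m$ matrix, $s=\min(n,m)$, with $d_1,\ldots,d_s$ on the main diagonal (starting at the upper left corner) and zeros elsewhere. $A\sim B$ (equivalence) means $A=PBQ$ for some invertible square matrices $P,Q$ over $R$ of suitable sizes. $R$ is an elementary divisor ring if for every (possibly rectangular) matrix $A$ over $R$ there are invertible matrices $P,Q$ of suitable sizes with $PAQ=\mathrm{diag}(d_1,\ldots,d_k,0,\ldots,0)$ and $Rd_{i+1}R\subseteq d_iR\cap Rd_i$ for $i=1,\ldots,k-1$. A nonzero element $a\in R$ is duo if $aR$ and $Ra$ are two-sided ideals and $aR=Ra$. $R$ has the $D$-property if for each $a\in R$ there is $a_*\in R$ with $RaR=a_*R=Ra_*$. $R$ has the $K$-property if each factor of a duo element is a duo element, where $b$ is a factor of $a$ if $a=xby$ for some $x,y\in R$. $R$ has the $DK$-property if it has both the $D$-property and the $K$-property. *)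

(* Defs.v *)
From HB Require Import structures.
From mathcomp Require Import all_boot all_order all_algebra.
From mathcomp Require Import classical_sets.
Set Implicit Arguments. Unset Strict Implicit. Unset Printing Implicit Defensive.
Import GRing.Theory.
Local Open Scope ring_scope.
Local Open Scope classical_set_scope.

Section Ideals.
Variable R : nzRingType.
Implicit Types (a b : R) (I : set R).

(* aR *)
Definition rprincipal a : set R := [set a * x | x in setT].

(* Ra *)
Definition lprincipal a : set R := [set x * a | x in setT].

(* RaR, the set of finite sums of elements x * a * y *)
Definition tprincipal a : set R :=
  [set \sum_(p <- s) p.1 * a * p.2 | s in [set: seq (R * R)]].

Definition two_sided_ideal I : Prop :=
  [/\ I 0,
      forall x y, I x -> I y -> I (x - y) &
      forall r x, I x -> I (r * x) /\ I (x * r)].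

Definition duo a : Prop :=
  [/\ a != 0,
      two_sided_ideal (rprincipal a),
      two_sided_ideal (lprincipal a) &
      rprincipal a = lprincipal a].

Definition is_factor b a : Prop := exists x y : R, a = x * b * y.

End Ideals.

Definition D_property (R : nzRingType) : Prop :=
  forall a : R, exists a' : R,
    tprincipal a = rprincipal a' /\ rprincipal a' = lprincipal a'.

Definition K_property (R : nzRingType) : Prop :=
  forall a b : R, duo a -> is_factor b a -> duo b.

Definition DK_property (R : nzRingType) : Prop :=
  D_property R /\ K_property R.

Section Matrices.
Variable R : nzRingType.

(* [unitmx] is only available over commutative rings. *)
Definition invertible_mx n (P : 'M[R]_n) : Prop :=
  exists P' : 'M[R]_n, P *m P' = 1%:M /\ P' *m P = 1%:M.

Definition equiv_mx m n (A B : 'M[R]_(m, n)) : Prop :=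
  exists (P : 'M[R]_m) (Q : 'M[R]_n),
    [/\ invertible_mx P, invertible_mx Q & A = P *m B *m Q].

(* The rectangular matrix diag(d_1, ..., d_k, 0, ..., 0) with k = size d: past
   the end of d, the entry d`_i is 0. *)
Definition rect_diag m n (d : seq R) : 'M[R]_(m, n) :=
  \matrix_(i, j) (if i == j :> nat then d`_i else 0).

End Matrices.

Definition elementary_divisor_ring (R : nzRingType) : Prop :=
  forall (m n : nat) (A : 'M[R]_(m, n)),
  exists (P : 'M[R]_m) (Q : 'M[R]_n) (d : seq R),
    [/\ invertible_mx P, invertible_mx Q, (size d <= minn m n)%N,
        P *m A *m Q = rect_diag m n d &
        forall i : nat, (i.+1 < size d)%N ->
          tprincipal d`_i.+1 `<=` rprincipal d`_i `&` lprincipal d`_i].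

(* Main.v *)
Require Import Defs.
From HB Require Import structures.
From mathcomp Require Import all_boot all_order all_algebra.
From mathcomp Require Import classical_sets.
Set Implicit Arguments. Unset Strict Implicit. Unset Printing Implicit Defensive.
Import GRing.Theory.
Local Open Scope ring_scope.
Local Open Scope classical_set_scope.

(** Take the diagonal form [d_1, ..., d_k, 0, ...] given by the elementary
    divisor property. The divisibility [R d_(i+1) R `<=` d_i R `&` R d_i] forces
    every entry after a zero entry to be zero, so cutting [d] at its first zero
    does not change the diagonal matrix, and one may assume all [d_i] nonzero
    ([nth_take_find0]). By the D-property, [R d_(i+1) R = a R = R a] for some
    [a], which is nonzero since [d_(i+1)] is, hence duo. As [a] lies in
    [R d_(i+1) R `<=` d_i R], the entry [d_i] is a factor of [a], and the
    K-property makes it duo ([duo_of_tprincipal_sub]). Thus the given diagonal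
    form already has all the required properties. *)

Section Ideals.
Variable R : nzRingType.
Implicit Types a b : R.

Lemma mem_tprincipal a : tprincipal a a.
Proof. by exists [:: (1, 1)] => //; rewrite big_seq1 mul1r mulr1. Qed.

Lemma two_sided_tprincipal a : two_sided_ideal (tprincipal a).
Proof.
split.
- by exists [::] => //; rewrite big_nil.
- move=> _ _ [s _ <-] [t _ <-].
  exists (s ++ [seq (- p.1, p.2) | p <- t]) => //.
  rewrite big_cat big_map /= -sumrN; congr (_ + _).
  by apply: eq_bigr => p _; rewrite !mulNr.
- move=> r _ [s _ <-]; split.
  + exists [seq (r * p.1, p.2) | p <- s] => //.
    by rewrite big_map mulr_sumr; apply: eq_bigr => p _; rewrite !mulrA.
  + exists [seq (p.1, p.2 * r) | p <- s] => //.
    by rewrite big_map mulr_suml; apply: eq_bigr => p _; rewrite !mulrA.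
Qed.

Lemma duo_tprincipal_generator a b :
  b != 0 -> tprincipal b = rprincipal a -> rprincipal a = lprincipal a -> duo a.
Proof.
move=> nz_b ba aa; split=> //; rewrite -?aa -?ba;
  try exact: two_sided_tprincipal.
apply: contra_neq nz_b => a0; move: (mem_tprincipal b).
by rewrite ba a0 => -[x _ <-]; rewrite mul0r.
Qed.

(** A generator of the ideal [R b R], nonzero because [b] is, is a duo element
    having [a] as a left factor. *)
Lemma duo_of_tprincipal_sub a b :
  DK_property R -> b != 0 -> tprincipal b `<=` rprincipal a -> duo a.
Proof.
move=> [D K] nz_b sub_ba; have [c [bc cc]] := D b.
apply: (K c); first exact: duo_tprincipal_generator nz_b bc cc.
have c_b : tprincipal b c by rewrite bc; exists 1; rewrite ?mulr1.
have [x _ cE] := sub_ba c c_b.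
by exists 1, x; rewrite mul1r.
Qed.

(** Entries of a divisibility chain after its first zero vanish, just as the
    default value returned past the end of the sequence. *)
Lemma nth_take_find0 (d : seq R) :
  (forall i, (i.+1 < size d)%N -> tprincipal d`_i.+1 `<=` rprincipal d`_i) ->
  forall i, (take (find (pred1 0%R) d) d)`_i = d`_i.
Proof.
move=> sub_d i; set k := find _ d.
have [lt_ik|le_ki] := ltnP i k; first by rewrite nth_take.
rewrite nth_default ?size_take_min ?geq_min ?le_ki //; apply/esym.
rewrite -(subnKC le_ki); elim: (i - k)%N => [|j IHj].
  rewrite addn0; have [d0|nd0] := boolP (has (pred1 0%R) d).
    exact/eqP/(nth_find 0 d0).
  by rewrite nth_default // /k hasNfind.
rewrite addnS; have [lt_d|le_d] := ltnP (k + j).+1 (size d); last first.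
  exact: nth_default.
have [x _ <-] := sub_d _ lt_d _ (mem_tprincipal _).
by rewrite IHj mul0r.
Qed.

Lemma nth_take_find0_neq0 (d : seq R) i :
  (i < size (take (find (pred1 0%R) d) d))%N ->
  (take (find (pred1 0%R) d) d)`_i != 0.
Proof.
rewrite size_take_min leq_min => /andP[lt_i _].
by rewrite nth_take //; apply: negbT; exact: (before_find 0 lt_i).
Qed.

End Ideals.

Lemma eq_rect_diag (R : nzRingType) m n (d e : seq R) :
  (forall i, d`_i = e`_i) -> rect_diag m n d = rect_diag m n e.
Proof. by move=> de; apply/matrixP=> i j; rewrite !mxE de. Qed.

Lemma equiv_mx_of_mul (R : nzRingType) m n (A B : 'M[R]_(m, n)) P Q :
  invertible_mx P -> invertible_mx Q -> P *m A *m Q = B -> equiv_mx A B.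
Proof.
move=> [P' [PP' P'P]] [Q' [QQ' Q'Q]] <-.
exists P', Q'; split; [by exists P | by exists Q |].
by rewrite !mulmxA P'P mul1mx -mulmxA QQ' mulmx1.
Qed.

Theorem theorem2p2 (R : nzRingType)
    (hED : elementary_divisor_ring R) (hDK : DK_property R)
    (m n : nat) (A : 'M[R]_(m, n)) :
  exists e : seq R,
    [/\ (size e <= minn m n)%N,
        equiv_mx A (rect_diag m n e),
        forall i : nat, (i.+1 < size e)%N -> duo e`_i &
        forall i : nat, (i.+1 < size e)%N ->
          tprincipal e`_i.+1 `<=` lprincipal e`_i `&` rprincipal e`_i].
Proof.
have [P [Q [d [invP invQ size_d PAQ sub_d]]]] := hED m n A.
have sub_dr i : (i.+1 < size d)%N -> tprincipal d`_i.+1 `<=` rprincipal d`_i.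
  by move=> lt_i x /(sub_d i lt_i)[].
have eE := nth_take_find0 sub_dr; have e_neq0 := @nth_take_find0_neq0 R d.
move: eE e_neq0; set e := take _ d => eE e_neq0.
have le_ed : (size e <= size d)%N by rewrite size_take_min geq_minr.
exists e; split.
- exact: leq_trans le_ed size_d.
- by apply: (equiv_mx_of_mul invP invQ); rewrite (eq_rect_diag _ _ eE).
- move=> i lt_i; apply: (duo_of_tprincipal_sub hDK (e_neq0 _ lt_i)).
  by rewrite !eE; apply: sub_dr; apply: leq_trans le_ed.
- move=> i lt_i; rewrite !eE setIC; apply: sub_d; exact: leq_trans le_ed.
Qed.
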